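(* Let $A$ be a multipermutation skew brace and let $X\subseteq A$. If $X$ generates $A$ as a strong left ideal, then $X$ generates $A$ as a skew brace.
   Context: A skew brace is a triple $(A,+,\circ)$ with $(A,+)$, $(A,\circ)$ groups (not necessarily abelian) and $a\circ(b+c)=a\circ b-a+a\circ c$. Put $\lambda_a(b)=-a+a\circ b$. A strong left ideal is a normal subgroup $I$ of $(A,+)$ with $\lambda_a(I)\subseteq I$ for all $a\in A$; an ideal is a strong left ideal that is also normal in $(A,\circ)$. $\mathrm{Soc}(A)=\{x\in A\mid x\circ a=x+a=a+x\ \forall a\in A\}$ is an ideal; set $\mathrm{Ret}(A)=A/\mathrm{Soc}(A)$, $\mathrm{Ret}^0(A)=A$, $\mathrm{Ret}^{n+1}(A)=\mathrm{Ret}(\mathrm{Ret}^n(A))$. $A$ is a multipermutation skew brace if $\mathrm{Ret}^n(A)=0$ for some $n\ge 0$. A subset $X\subseteq A$ generates $A$ as a strong left ideal (respectively as a skew brace) if the smallest strong left ideal (respectively the smallest subskew brace, i.e. subset that is a subgroup of both $(A,+)$ and $(A,\circ)$) of $A$ containing $X$ is $A$. *)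

(* Defs.v *)
From HB Require Import structures.
From mathcomp Require Import all_boot.
From mathcomp Require Import boolp classical_sets.

Set Implicit Arguments.
Unset Strict Implicit.
Unset Printing Implicit Defensive.

Local Open Scope classical_set_scope.
Local Open Scope quotient_scope.

(* The product of [groupType] is the circle operation; the unit and inverse of
   (A, ∘) are written [1%g] and [x^-1%g]. *)
Notation "x ∘ y" := (x * y)%g (at level 40, left associativity).

(* Addition need not be commutative, so it is not a [zmodType] structure.  The
   [choiceType] inherited from [Group] is no restriction on the carrier in the
   presence of the axioms of [boolp]. *)
HB.mixin Record Group_isSkewBrace A of Group A := {
  skadd : A -> A -> A;
  skzero : A;
  skopp : A -> A;
  skaddA : associative skadd;
  skadd0 : left_id skzero skadd;
  skaddN : left_inverse skzero skopp skadd;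
  skcircD : forall a b c : A,
    a ∘ skadd b c = skadd (skadd (a ∘ b) (skopp a)) (a ∘ c)
}.

#[short(type="skewBraceType")]
HB.structure Definition SkewBrace := {A of Group_isSkewBrace A & Group A}.

Declare Scope skew_brace_scope.
Delimit Scope skew_brace_scope with SB.
Bind Scope skew_brace_scope with SkewBrace.sort.
Notation "0" := (@skzero _) : skew_brace_scope.
Notation "x + y" := (skadd x y) : skew_brace_scope.
Notation "- x" := (skopp x) : skew_brace_scope.
Notation "x - y" := (skadd x (skopp y)) : skew_brace_scope.
Local Open Scope skew_brace_scope.

Definition is_subgroup (T : Type) (op : T -> T -> T) (e : T) (inv : T -> T)
    (S : set T) : Prop :=
  [/\ S e, forall x y, S x -> S y -> S (op x y) & forall x, S x -> S (inv x)].

Definition is_normal_subgroup (T : Type) (op : T -> T -> T) (e : T)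
    (inv : T -> T) (S : set T) : Prop :=
  is_subgroup op e inv S /\ forall a x, S x -> S (op (op a x) (inv a)).

Section Basics.
Variable A : skewBraceType.
Implicit Types (a b c x y : A) (I X : set A).

Definition lambda a b : A := - a + a ∘ b.

Definition add_subgroup I : Prop :=
  is_subgroup (fun x y => x + y) 0 (fun x => - x) I.

Definition circ_subgroup I : Prop :=
  is_subgroup (fun x y => x ∘ y) 1%g (fun x => x^-1%g) I.

Definition add_normal I : Prop :=
  is_normal_subgroup (fun x y => x + y) 0 (fun x => - x) I.

Definition circ_normal I : Prop :=
  is_normal_subgroup (fun x y => x ∘ y) 1%g (fun x => x^-1%g) I.

Definition strong_left_ideal I : Prop :=
  add_normal I /\ forall a, lambda a @` I `<=` I.

Definition ideal I : Prop := strong_left_ideal I /\ circ_normal I.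

Definition subskewbrace I : Prop := add_subgroup I /\ circ_subgroup I.

Definition Soc : set A := [set x | forall a, x ∘ a = x + a /\ x + a = a + x].

Definition generates_as_strong_left_ideal X : Prop :=
  smallest strong_left_ideal X = setT.

Definition generates_as_skew_brace X : Prop :=
  smallest subskewbrace X = setT.

Lemma skadd0r x : x + 0 = x.
Proof.
have e y : y + y = y -> y = 0 by move=> h; rewrite -[LHS]skadd0 -(skaddN y) -skaddA h.
have xN : x - x = 0.
  by apply: e; rewrite skaddA -[x - x + x]skaddA skaddN -[x + 0 - x]skaddA skadd0.
by rewrite -(skaddN x) skaddA xN skadd0.
Qed.

Lemma skaddNr x : x - x = 0.
Proof.
rewrite -[LHS]skadd0 -{1}(skaddN (- x)) -skaddA (skaddA (- x)) skaddN skadd0.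
exact: skaddN.
Qed.

Lemma skaddK x y : x + y - y = x.
Proof. by rewrite -skaddA skaddNr skadd0r. Qed.

Lemma skaddNK x y : x - y + y = x.
Proof. by rewrite -skaddA skaddN skadd0r. Qed.

Lemma skNaddK x y : - x + (x + y) = y.
Proof. by rewrite skaddA skaddN skadd0. Qed.

Lemma skaddNKl x y : x + (- x + y) = y.
Proof. by rewrite skaddA skaddNr skadd0. Qed.

Lemma skaddI a x y : a + x = a + y -> x = y.
Proof. by move=> h; rewrite -(skNaddK a x) h skNaddK. Qed.

Lemma skaddIr a x y : x + a = y + a -> x = y.
Proof. by move=> h; rewrite -(skaddK x a) h skaddK. Qed.

Lemma skoppK x : - - x = x.
Proof. by apply: (@skaddI (- x)); rewrite skaddNr skaddN. Qed.

Lemma skopp0 : - 0 = 0 :> A.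
Proof. by rewrite -[LHS]skadd0 skaddNr. Qed.

Lemma skoppD x y : - (x + y) = - y - x.
Proof. by apply: (@skaddI (x + y)); rewrite skaddNr skaddA skaddK skaddNr. Qed.

Lemma circ0 a : a ∘ 0 = a.
Proof.
have := skcircD a 0 0; rewrite skadd0 => /esym.
rewrite -[RHS]skadd0 => /skaddIr h.
by rewrite -(skaddNK (a ∘ 0) a) h skadd0.
Qed.

Lemma sk1E : 1%g = 0 :> A.
Proof. by rewrite -[RHS]mul1g circ0. Qed.

Lemma skcircE a b : a ∘ b = a + lambda a b.
Proof. by rewrite /lambda skaddNKl. Qed.

Lemma lambdaD a b c : lambda a (b + c) = lambda a b + lambda a c.
Proof. by rewrite /lambda skcircD !skaddA. Qed.

Lemma lambda0 a : lambda a 0 = 0.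
Proof. by rewrite /lambda circ0 skaddN. Qed.

Lemma lambdaN a b : lambda a (- b) = - lambda a b.
Proof.
by apply: (@skaddI (lambda a b)); rewrite -lambdaD !skaddNr lambda0.
Qed.

Lemma lambdaM a b c : lambda (a ∘ b) c = lambda a (lambda b c).
Proof.
apply: (@skaddI (a ∘ b)); rewrite -skcircE -mulgA [b ∘ c]skcircE skcircD.
by rewrite -skaddA.
Qed.

Lemma lambda1 c : lambda 1%g c = c.
Proof. by rewrite /lambda mul1g sk1E skopp0 skadd0. Qed.

Lemma lambdaK a c : lambda a (lambda a^-1%g c) = c.
Proof. by rewrite -lambdaM mulgV lambda1. Qed.

Lemma Soc_central x : Soc x -> forall a, x + a = a + x.
Proof. by move=> h a; case: (h a). Qed.

Lemma Soc_circ x : Soc x -> forall a, x ∘ a = x + a.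
Proof. by move=> h a; case: (h a). Qed.

Lemma SocV x : Soc x -> x^-1%g = - x.
Proof.
by move=> sx; apply: (@skaddI x); rewrite -Soc_circ // mulgV sk1E skaddNr.
Qed.

Lemma Soc0 : Soc 0.
Proof. by move=> a; rewrite skadd0 skadd0r -{1}sk1E mul1g. Qed.

Lemma SocD x y : Soc x -> Soc y -> Soc (x + y).
Proof.
move=> sx sy a; split.
  by rewrite -(Soc_circ sx) -mulgA (Soc_circ sy) (Soc_circ sx) (Soc_circ sx) skaddA.
by rewrite -skaddA (Soc_central sy) !skaddA (Soc_central sx).
Qed.

Lemma SocN x : Soc x -> Soc (- x).
Proof.
move=> sx a; split.
  rewrite -(SocV sx); apply: (mulgI x); rewrite mulgA mulgV mul1g (Soc_circ sx).
  by rewrite (SocV sx) skaddNKl.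
apply: (@skaddI x); rewrite skaddNKl skaddA (Soc_central sx).
by rewrite skaddK.
Qed.

Lemma Soc_conj_lambda a x : Soc x -> a ∘ x ∘ a^-1%g = lambda a x.
Proof.
move=> sx; rewrite -mulgA (Soc_circ sx) skcircD mulgV sk1E skadd0r skcircE.
have -> : a + lambda a x = lambda a x + a.
  rewrite -[a in LHS](lambdaK a) -[a in RHS](lambdaK a).
  by rewrite !lambdaK -{1}(lambdaK a a) -lambdaD -(Soc_central sx) lambdaD lambdaK.
by rewrite skaddK.
Qed.

Lemma Soc_lambda a x : Soc x -> Soc (lambda a x).
Proof.
move=> sx b; split.
  rewrite skcircE; congr (_ + _).
  rewrite -(Soc_conj_lambda a sx) !lambdaM.
  by rewrite {2}/lambda (Soc_circ sx) skNaddK lambdaK.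
by rewrite -(lambdaK a b) -!lambdaD (Soc_central sx).
Qed.

Lemma Soc_ideal : ideal Soc.
Proof.
split; split; [split; first split| |split|].
- exact: Soc0.
- exact: SocD.
- exact: SocN.
- by move=> a x sx /=; rewrite -(Soc_central sx) skaddK.
- by move=> a _ [x sx <-]; exact: Soc_lambda.
- by rewrite sk1E; exact: Soc0.
- by move=> x y sx sy; rewrite (Soc_circ sx); exact: SocD.
- by move=> x sx; rewrite (SocV sx); exact: SocN.
- by move=> a x sx; rewrite Soc_conj_lambda //; exact: Soc_lambda.
Qed.

End Basics.

Section Quotient.
Variables (A : skewBraceType) (I : set A) (idI : ideal I).
Implicit Types a b c x y : A.

Let I0 : I 0. Proof. by case: idI => -[[[]]]. Qed.
Let ID x y : I x -> I y -> I (x + y).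
Proof. by case: idI => -[[[_ h _] _] _] _; exact: h. Qed.
Let IN x : I x -> I (- x).
Proof. by case: idI => -[[[_ _ h] _] _] _; exact: h. Qed.
Let IJ a x : I x -> I (a + x - a).
Proof. by case: idI => -[[_ h] _] _; exact: h. Qed.
Let IL a x : I x -> I (lambda a x).
Proof. by case: idI => -[_ h] _ Ix; apply: (h a); exists x. Qed.
Let ICV x : I x -> I x^-1%g.
Proof. by case: idI => _ [[_ _ h] _]; exact: h. Qed.
Let ICJ a x : I x -> I (a ∘ x ∘ a^-1%g).
Proof. by case: idI => _ [_ h]; exact: h. Qed.

(* Since I is an ideal, the additive cosets a + I are also the cosets a ∘ I. *)
Definition coset_rel : rel A := fun a b => `[< I (- a + b) >].

Lemma coset_rel_refl : reflexive coset_rel.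
Proof. by move=> a; apply/asboolP; rewrite skaddN. Qed.

Lemma coset_rel_sym : symmetric coset_rel.
Proof.
have h a b : coset_rel a b -> coset_rel b a.
  by move=> /asboolP /IN; rewrite skoppD skoppK => ?; apply/asboolP.
by move=> a b; apply/idP/idP; exact: h.
Qed.

Lemma coset_rel_trans : transitive coset_rel.
Proof.
move=> b a c /asboolP h1 /asboolP h2; apply/asboolP.
by have := ID h1 h2; rewrite -skaddA skaddNKl.
Qed.

Canonical coset_equiv :=
  EquivRel coset_rel coset_rel_refl coset_rel_sym coset_rel_trans.

Definition quotient_brace : Type := {eq_quot coset_equiv}.

Local Notation Q := quotient_brace.

HB.instance Definition _ := Choice.copy Q {eq_quot coset_equiv}.
HB.instance Definition _ := EqQuotient.copy Q {eq_quot coset_equiv}.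

Lemma coset_relP a b : reflect (exists2 x, I x & b = a + x) (coset_rel a b).
Proof.
apply: (iffP (asboolP _)) => [h|[x Ix ->]]; last by rewrite skNaddK.
by exists (- a + b) => //; rewrite skaddNKl.
Qed.

Lemma quot_eqP a b : reflect (\pi_Q a = \pi_Q b) (coset_rel a b).
Proof.
apply: (iffP idP) => [h|/eqquotP//].
by apply/eqquotP.
Qed.

Lemma coset_relD a a' b b' :
  coset_rel a a' -> coset_rel b b' -> coset_rel (a + b) (a' + b').
Proof.
move=> /coset_relP[x Ix ->] /coset_relP[y Iy ->]; apply/asboolP.
rewrite skoppD -!skaddA skNaddK.
have -> : - b + (x + (b + y)) = (- b + x - (- b)) + y by rewrite skoppK !skaddA.
by apply: ID => //; exact: IJ.
Qed.

Lemma coset_relN a a' : coset_rel a a' -> coset_rel (- a) (- a').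
Proof.
move=> /coset_relP[x Ix ->]; apply/asboolP.
rewrite skoppD skoppK skaddA.
by apply: IJ; exact: IN.
Qed.

Lemma coset_rel_circP a b : reflect (exists2 x, I x & b = a ∘ x) (coset_rel a b).
Proof.
apply: (iffP (coset_relP _ _)) => -[x Ix ->].
  by exists (lambda a^-1%g x); [exact: IL|rewrite skcircE lambdaK].
by exists (lambda a x); [exact: IL|rewrite skcircE].
Qed.

Lemma coset_relM a a' b b' :
  coset_rel a a' -> coset_rel b b' -> coset_rel (a ∘ b) (a' ∘ b').
Proof.
move=> /coset_rel_circP[x Ix ->] /coset_rel_circP[y Iy ->].
apply/coset_rel_circP; exists ((b^-1%g ∘ x ∘ b) ∘ y); last first.
  by rewrite !mulgA mulgK.
case: idI => _ [[_ h _] _]; apply: h => //.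
by rewrite -[X in _ ∘ X]invgK; exact: ICJ.
Qed.

Lemma coset_relV a a' : coset_rel a a' -> coset_rel a^-1%g a'^-1%g.
Proof.
move=> /coset_rel_circP[x Ix ->]; apply/coset_rel_circP.
exists (a ∘ x^-1%g ∘ a^-1%g); first by apply: ICJ; exact: ICV.
by rewrite !mulgA mulVg mul1g invgM.
Qed.

Definition quot_add (u v : Q) : Q := \pi_Q (repr u + repr v).
Definition quot_opp (u : Q) : Q := \pi_Q (- repr u).
Definition quot_zero : Q := \pi_Q 0.
Definition quot_circ (u v : Q) : Q := \pi_Q (repr u ∘ repr v).
Definition quot_inv (u : Q) : Q := \pi_Q (repr u)^-1%g.
Definition quot_one : Q := \pi_Q 1%g.

Let reprP a : coset_rel (repr (\pi_Q a)) a.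
Proof. by apply/quot_eqP; rewrite reprK. Qed.

Lemma pi_add a b : quot_add (\pi_Q a) (\pi_Q b) = \pi_Q (a + b).
Proof. by apply/quot_eqP; apply: coset_relD; exact: reprP. Qed.

Lemma pi_opp a : quot_opp (\pi_Q a) = \pi_Q (- a).
Proof. by apply/quot_eqP; apply: coset_relN; exact: reprP. Qed.

Lemma pi_circ a b : quot_circ (\pi_Q a) (\pi_Q b) = \pi_Q (a ∘ b).
Proof. by apply/quot_eqP; apply: coset_relM; exact: reprP. Qed.

Lemma pi_inv a : quot_inv (\pi_Q a) = \pi_Q a^-1%g.
Proof. by apply/quot_eqP; apply: coset_relV; exact: reprP. Qed.

Lemma quot_circA : associative quot_circ.
Proof.
elim/quotW => a; elim/quotW => b; elim/quotW => c.
by rewrite (pi_circ b c) (pi_circ a b) !pi_circ mulgA.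
Qed.

Lemma quot_circ1 : left_id quot_one quot_circ.
Proof. by elim/quotW => a; rewrite pi_circ mul1g. Qed.

Lemma quot_circr1 : right_id quot_one quot_circ.
Proof. by elim/quotW => a; rewrite pi_circ mulg1. Qed.

Lemma quot_circV : left_inverse quot_one quot_inv quot_circ.
Proof. by elim/quotW => a; rewrite pi_inv pi_circ mulVg. Qed.

Lemma quot_circrV : right_inverse quot_one quot_inv quot_circ.
Proof. by elim/quotW => a; rewrite pi_inv pi_circ mulgV. Qed.

HB.instance Definition _ :=
  isGroup.Build Q quot_circA quot_circ1 quot_circr1 quot_circV quot_circrV.

Lemma quot_addA : associative quot_add.
Proof.
elim/quotW => a; elim/quotW => b; elim/quotW => c.
by rewrite (pi_add b c) (pi_add a b) !pi_add skaddA.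
Qed.

Lemma quot_add0 : left_id quot_zero quot_add.
Proof. by elim/quotW => a; rewrite pi_add skadd0. Qed.

Lemma quot_addN : left_inverse quot_zero quot_opp quot_add.
Proof. by elim/quotW => a; rewrite pi_opp pi_add skaddN. Qed.

Lemma quot_circD (u v w : Q) :
  u ∘ quot_add v w = quot_add (quot_add (u ∘ v) (quot_opp u)) (u ∘ w).
Proof.
elim/quotW: u => a; elim/quotW: v => b; elim/quotW: w => c.
change (quot_circ (\pi_Q a) (quot_add (\pi_Q b) (\pi_Q c)) =
  quot_add (quot_add (quot_circ (\pi_Q a) (\pi_Q b)) (quot_opp (\pi_Q a)))
           (quot_circ (\pi_Q a) (\pi_Q c))).
by rewrite pi_opp (pi_add b c) !pi_circ (pi_add (a ∘ b)) pi_add skcircD.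
Qed.

HB.instance Definition _ := Group_isSkewBrace.Build Q
  quot_addA quot_add0 quot_addN quot_circD.

End Quotient.

Definition Ret (A : skewBraceType) : skewBraceType :=
  quotient_brace (@Soc_ideal A).

Definition multipermutation (A : skewBraceType) : Prop :=
  exists n : nat, forall x : iter n Ret A, x = 0.

(* Main.v *)
Require Import Defs.
From mathcomp Require Import all_boot.
From mathcomp Require Import classical_sets.

(** By induction on the multipermutation level, a subskew brace [B] containing
    [X] maps onto [Ret A], that is, [A = B + Soc A].  Elements of the socle are
    additively central and act trivially through [lambda], so normality and
    [lambda]-invariance of [B] need only be tested on elements of [B]: hence
    [B] is a strong left ideal, and [B = A]. *)

Set Implicit Arguments.
Unset Strict Implicit.
Unset Printing Implicit Defensive.

Local Open Scope classical_set_scope.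
Local Open Scope quotient_scope.
Local Open Scope skew_brace_scope.

(** [smallest C X] is the intersection of the members of [C] containing [X], so it is everything iff
    each of them is. *)
Lemma smallest_eqT (T : Type) (C : set (set T)) (X : set T) :
  smallest C X = setT <-> forall M, C M -> X `<=` M -> M = setT.
Proof.
split=> [XT M CM XM|h]; apply/seteqP; split=> // x _.
  by have : smallest C X x; [rewrite XT | apply].
by move=> M [CM XM]; rewrite (h M).
Qed.

Section Quotient.
Variables (A : skewBraceType) (I : set A) (idI : ideal I).

(** The codomain is fixed so that the laws below use the skew brace operations instead of [quot_add]
    and its companions. *)
Definition quot_proj (a : A) : quotient_brace idI := \pi_(quotient_brace idI) a.

Lemma quot_proj_surj u : exists a, u = quot_proj a.
Proof. by elim/quotW: u => a; exists a. Qed.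

Lemma quot_projD a b : quot_proj (a + b) = quot_proj a + quot_proj b.
Proof. exact/esym/pi_add. Qed.

Lemma quot_projN a : quot_proj (- a) = - quot_proj a.
Proof. exact/esym/pi_opp. Qed.

Lemma quot_projM a b : quot_proj (a ∘ b) = quot_proj a ∘ quot_proj b.
Proof. exact/esym/pi_circ. Qed.

Lemma quot_projV a : quot_proj a^-1%g = (quot_proj a)^-1%g.
Proof. exact/esym/pi_inv. Qed.

Lemma quot_proj_lambda a b :
  quot_proj (lambda a b) = lambda (quot_proj a) (quot_proj b).
Proof. by rewrite /lambda quot_projD quot_projN quot_projM. Qed.

Lemma quot_proj_eq a b :
  quot_proj a = quot_proj b -> exists2 x, I x & b = a + x.
Proof. by move=> /quot_eqP/coset_relP. Qed.

Lemma strong_left_ideal_preimage (J : set (quotient_brace idI)) :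
  strong_left_ideal J -> strong_left_ideal (quot_proj @^-1` J).
Proof.
move=> [[[J0 JD JN] JJ] JL]; split; first split; first split => //=.
- by move=> x y Jx Jy; rewrite /= quot_projD; exact: JD.
- by move=> x Jx; rewrite /= quot_projN; exact: JN.
- by move=> a x Jx; rewrite /= !quot_projD quot_projN; exact: JJ.
- move=> a _ [x Jx <-]; rewrite /= quot_proj_lambda.
  by apply: (JL (quot_proj a)); exists (quot_proj x).
Qed.

Lemma subskewbrace_image (B : set A) :
  subskewbrace B -> subskewbrace (quot_proj @` B).
Proof.
move=> [[B0 BD BN] [B1 BM BV]]; split; split.
- by exists 0.
- by move=> _ _ [x Bx <-] [y By <-]; rewrite -quot_projD; exists (x + y); auto.
- by move=> _ [x Bx <-]; rewrite -quot_projN; exists (- x); auto.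
- by exists 1%g.
- by move=> _ _ [x Bx <-] [y By <-]; rewrite -quot_projM; exists (x ∘ y); auto.
- by move=> _ [x Bx <-]; rewrite -quot_projV; exists x^-1%g; auto.
Qed.

(** A strong left ideal containing the image of [X] pulls back to one containing [X], hence to all
    of [A]; surjectivity concludes. *)
Lemma generates_as_strong_left_ideal_image (X : set A) :
  generates_as_strong_left_ideal X ->
  generates_as_strong_left_ideal (quot_proj @` X).
Proof.
move=> /smallest_eqT XT; apply/smallest_eqT => J sJ XJ.
have preT := XT _ (strong_left_ideal_preimage sJ).
apply/seteqP; split=> // u _; have [a ->] := quot_proj_surj u.
have : (quot_proj @^-1` J) a by rewrite preT // => x Xx; apply: XJ; exists x.
exact.
Qed.

End Quotient.

Lemma lambda_Soc (A : skewBraceType) (s c : A) : Soc s -> lambda s c = c.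
Proof. by move=> ss; rewrite /lambda Soc_circ // skNaddK. Qed.

Lemma strong_left_ideal_cover_Soc (A : skewBraceType) (B : set A) :
  subskewbrace B -> (forall a, exists b s, [/\ B b, Soc s & a = b + s]) ->
  strong_left_ideal B.
Proof.
move=> [[B0 BD BN] [B1 BM BV]] cover; split; first split => // a x Bx.
  have [b [s [Bb ss ->]]] := cover a.
  (* Since [s] is central, conjugation by [b + s] is conjugation by [b]. *)
  rewrite skoppD -(skaddA b) (Soc_central ss) !skaddA skaddK.
  by apply: (BD); [exact: BD | exact: BN].
move=> a _ [x Bx <-]; have [b [s [Bb ss ->]]] := cover a.
(* As [b + s = s + b = s ∘ b], [lambda (b + s)] is [lambda s] after [lambda b], and [lambda s] is
   the identity. *)
rewrite -(Soc_central ss) -(Soc_circ ss) lambdaM lambda_Soc //.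
by apply: (BD); [exact: BN | exact: BM].
Qed.

Theorem theorem4p5 (A : skewBraceType) (X : set A)
    (hA : multipermutation A)
    (hX : generates_as_strong_left_ideal X) :
  generates_as_skew_brace X.
Proof.
case: hA => n; elim: n => [|n IHn] in A X hX *.
  move=> A0; apply/smallest_eqT => B [[B0 _ _] _] _.
  by apply/seteqP; split=> // x _; rewrite (A0 x).
(* Peeling off the innermost [Ret] lets the induction hypothesis apply to [Ret A]. *)
rewrite iterSr => A0; apply/smallest_eqT => B sB XB.
(* By [hX], it is enough that [B] is a strong left ideal. *)
move/smallest_eqT: (hX); apply => //; apply: strong_left_ideal_cover_Soc => // a.
pose p := quot_proj (@Soc_ideal A).
have /smallest_eqT pX_gen :=
  IHn (Ret A) (p @` X) (generates_as_strong_left_ideal_image (@Soc_ideal A) hX) A0.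
have : (p @` B) (p a).
  by rewrite (pX_gen (p @` B)) //; [exact: subskewbrace_image | exact: image_subset].
by move=> [b Bb /quot_proj_eq[s ss ->]]; exists b, s.
Qed.
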